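(* Let $S\in\{O,F\}$ and let $G$ be an S-admissible graph without isolated vertices. Then $\gamma^{\rm STD}(G)\le\gamma^{\rm S}(G)+1$.
   Context: Let $G=(V,E)$ be a finite simple graph, $N(v)$ the open and $N[v]=N(v)\cup\{v\}$ the closed neighborhood of $v$. A set $C\subseteq V$ is: a total-dominating set if $N(v)\cap C\neq\emptyset$ for all $v\in V$; an open-separating set (O-set) if the sets $N(v)\cap C$, $v\in V$, are pairwise distinct; a full-separating set (F-set) if moreover the sets $N[v]\cap C$, $v\in V$, are pairwise distinct as well. $G$ is O-admissible if it has an O-set (equivalently, no two non-adjacent vertices have equal open neighborhoods), and F-admissible if it has an F-set (equivalently, additionally no two adjacent vertices have equal closed neighborhoods). An STD-code is a set that is both an S-set and a total-dominating set. $\gamma^{\rm S}(G)$ and $\gamma^{\rm STD}(G)$ denote the minimum cardinalities of an S-set and of an STD-code of $G$, respectively. *)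

(* Defs.v *)
From mathcomp Require Import all_boot.
Set Implicit Arguments.
Unset Strict Implicit.
Unset Printing Implicit Defensive.

Record sgraph := SGraph {
  vertex :> finType;
  edge : rel vertex;
  edge_sym : symmetric edge;
  edge_irrefl : irreflexive edge }.

Section Codes.
Variable G : sgraph.
Implicit Types (v : G) (C : {set G}).

Definition open_nbhd v : {set G} := [set u | edge v u].
Definition closed_nbhd v : {set G} := v |: open_nbhd v.

Definition no_isolated : Prop := forall v, open_nbhd v != set0.

Definition total_dominating C : bool :=
  [forall v, open_nbhd v :&: C != set0].

Definition open_separating C : bool :=
  injectiveb (fun v => open_nbhd v :&: C).

Definition closed_separating C : bool :=
  injectiveb (fun v => closed_nbhd v :&: C).

Definition full_separating C : bool :=
  open_separating C && closed_separating C.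

End Codes.

Variant separation := OpenSep | FullSep.

Definition S_set (S : separation) (G : sgraph) : pred {set G} :=
  match S with
  | OpenSep => @open_separating G
  | FullSep => @full_separating G
  end.

Definition STD_code (S : separation) (G : sgraph) : pred {set G} :=
  fun C => S_set S C && total_dominating C.

Definition admissible (S : separation) (G : sgraph) : Prop :=
  exists C : {set G}, S_set S C.

(* The default #|T| bounds every #|C|, so it does not affect the minimum of a
   nonempty family (see min_cardP); on an empty family the value is junk. *)
Definition min_card (T : finType) (P : pred {set T}) : nat :=
  \big[minn/#|T|]_(C : {set T} | P C) #|C|.

Definition gammaS (S : separation) (G : sgraph) : nat :=
  min_card (@S_set S G).

Definition gammaSTD (S : separation) (G : sgraph) : nat :=
  min_card (@STD_code S G).

Lemma min_card_le (T : finType) (P : pred {set T}) (C : {set T}) :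
  P C -> min_card P <= #|C|.
Proof.
move=> PC; rewrite /min_card; move: (mem_index_enum C).
elim: (index_enum _) => // D r IH; rewrite inE big_cons => /predU1P[<-|/IH le_r].
  by rewrite PC geq_minl.
by case: ifP => // _; rewrite geq_min le_r orbT.
Qed.

Lemma min_cardP (T : finType) (P : pred {set T}) :
  (exists C, P C) ->
  (exists2 C, P C & #|C| = min_card P) /\
  (forall C, P C -> min_card P <= #|C|).
Proof.
move=> [C0 PC0]; split; last exact: min_card_le.
have [//|E] : (exists2 C, P C & #|C| = min_card P) \/ min_card P = #|T|.
  rewrite /min_card; elim/big_ind: _ => [|m n Hm Hn|C PC]; first by right.
    by rewrite /minn; case: ifP.
  by left; exists C.
exists C0 => //; apply/eqP; rewrite eqn_leq min_card_le // andbT E.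
exact: max_card.
Qed.

Lemma S_setT (S : separation) (G : sgraph) :
  admissible S G -> S_set S [set: G].
Proof.
have inj (f : G -> {set G}) (C : {set G}) :
    injectiveb (fun v => f v :&: C) -> injectiveb (fun v => f v :&: setT).
  move=> /injectiveP fi; apply/injectiveP => u v; rewrite !setIT => E.
  by apply: fi; rewrite E.
case: S => -[C] /=; first exact: inj.
by case/andP=> o c; apply/andP; split; [exact: inj o | exact: inj c].
Qed.

Lemma STD_code_exists (S : separation) (G : sgraph) :
  admissible S G -> no_isolated G -> exists C : {set G}, STD_code S C.
Proof.
move=> adm iso; exists setT; rewrite /STD_code S_setT //=.
by apply/forallP => v; rewrite setIT.
Qed.

(* Main.v *)
Require Import Defs.
From mathcomp Require Import all_boot.

Set Implicit Arguments.
Unset Strict Implicit.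
Unset Printing Implicit Defensive.

(** Enlarging C cannot merge traces, so separation survives, and adding one
    neighbour of each undominated vertex makes C total-dominating. If C is
    open-separating, one added vertex suffices: all undominated vertices share
    the empty trace, hence coincide. *)

Lemma injectiveb_setIS (aT rT : finType) (f : aT -> {set rT})
    (C D : {set rT}) :
  C \subset D -> injectiveb (fun v => f v :&: C) ->
  injectiveb (fun v => f v :&: D).
Proof.
move=> /setIidPr DC /injectiveP inj_C; apply/injectiveP => u v eq_D.
by apply: inj_C; rewrite -DC !setIA eq_D.
Qed.

Section Separation.
Variable G : sgraph.
Implicit Types (S : separation) (C D : {set G}).

Lemma open_separatingS C D :
  C \subset D -> open_separating C -> open_separating D.
Proof. exact: injectiveb_setIS. Qed.

Lemma closed_separatingS C D :
  C \subset D -> closed_separating C -> closed_separating D.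
Proof. exact: injectiveb_setIS. Qed.

Lemma S_setS S C D : C \subset D -> S_set S C -> S_set S D.
Proof.
move=> sCD; case: S => /=; first exact: open_separatingS.
case/andP=> openC closedC; apply/andP; split.
  exact: open_separatingS openC.
exact: closed_separatingS closedC.
Qed.

Lemma S_set_open_separating S C : S_set S C -> open_separating C.
Proof. by case: S => //= /andP[]. Qed.

End Separation.

Section Domination.
Variable G : sgraph.
Implicit Types C D : {set G}.

Definition undominated C : {set G} := [set v | open_nbhd v :&: C == set0].

Lemma card_undominated_le1 C : open_separating C -> #|undominated C| <= 1.
Proof.
move=> /injectiveP inj_C; apply/card_le1_eqP => u v.
by rewrite !inE => /eqP u0 /eqP v0; apply: inj_C; rewrite u0 v0.
Qed.

Lemma total_dominating_extension C :
  no_isolated G ->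
  exists D, [/\ C \subset D, total_dominating D
              & #|D| <= #|C| + #|undominated C|].
Proof.
move=> noiso.
have /fin_all_exists[nbr nbrP] (v : G) : exists u, u \in open_nbhd v.
  exact/set0Pn/noiso.
exists (C :|: nbr @: undominated C); split; first exact: subsetUl.
- apply/forallP => v; rewrite setIUr setU_eq0 negb_and.
  have [undom_v | dom_v] := boolP (v \in undominated C).
    by apply/orP; right; apply/set0Pn; exists (nbr v); rewrite inE nbrP imset_f.
  by move: dom_v; rewrite inE => ->.
- by rewrite (leq_trans (leq_card_setU _ _)) // leq_add2l leq_imset_card.
Qed.

End Domination.

Theorem theorem4 (S : separation) (G : sgraph)
    (G_adm : admissible S G) (G_noiso : no_isolated G) :
  gammaSTD S G <= gammaS S G + 1.
Proof.
have [[C SC cardC] _] := min_cardP G_adm.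
have undomC := card_undominated_le1 (S_set_open_separating SC).
have [D [sCD domD cardD]] := total_dominating_extension C G_noiso.
have STD_D : STD_code S D by rewrite /STD_code (S_setS sCD SC).
apply: leq_trans (min_card_le STD_D) _.
by rewrite (leq_trans cardD) // /gammaS -cardC leq_add2l.
Qed.
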